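(* Let $G=([d],E)$ be a finite simple graph and $\lambda=(\lambda_1,\dots,\lambda_d)\in\mathbb{Z}_{>0}^d$. Then there exist graphs $H_1,\dots,H_\ell$, each on $\lambda_1+\cdots+\lambda_d$ vertices, and integers $k_1,\dots,k_\ell$ such that for all positive integers $n$, \[ \chi_G^\lambda(q,n) \;=\; \sum_{i=1}^\ell k_i\, \chi^{\mathbf 1}_{H_i}(q,n). \]
   Context: For a graph $H$ and a vector $\mu$ of positive integer vertex weights, $\chi_H^\mu(q,n):=\sum_c q^{\sum_{v}\mu_v c(v)}$, summed over proper colorings $c$ of $H$ with colors in $\{1,\dots,n\}$ ($c(u)\neq c(w)$ for every edge $uw$); $\mathbf 1$ denotes the all-ones weight vector. *)

(* Defs.v *)
From HB Require Import structures.
From mathcomp Require Import all_boot all_order all_algebra.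

Set Implicit Arguments.
Unset Strict Implicit.
Unset Printing Implicit Defensive.

Import GRing.Theory.
Local Open Scope ring_scope.

Record sgraph (V : finType) := SGraph {
  adj :> rel V;
  adj_sym : symmetric adj;
  adj_irrefl : irreflexive adj
}.

Definition proper_coloring (V : finType) (H : sgraph V) (n : nat)
    (c : {ffun V -> 'I_n}) : bool :=
  [forall u, forall w, H u w ==> (c u != c w)].

(* The indeterminate q is 'X, and the ordinal i : 'I_n stands for the color
   i.+1, so that the colors are 1, ..., n. *)
Definition wchrom (V : finType) (H : sgraph V) (mu : V -> nat) (n : nat) :
    {poly int} :=
  \sum_(c : {ffun V -> 'I_n} | proper_coloring H c)
    'X^(\sum_(v : V) mu v * (c v).+1)%N.

(* Main.v *)
(* Replace each vertex v by lambda v clones. A coloring of G of weight lambda is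
   a coloring of the clones that is constant on each fiber and proper for the
   pulled-back graph. Each requirement that two clones get the same color has
   indicator 1 - [different colors]; expanding the product of these factors
   turns the sum into a signed sum, over sets S of pairs of clones, of the
   chromatic polynomials of the pulled-back graph with the edges S added. *)

Require Import Defs.
From HB Require Import structures.
From mathcomp Require Import all_boot all_order all_algebra.

Set Implicit Arguments.
Unset Strict Implicit.
Unset Printing Implicit Defensive.

Import GRing.Theory.
Local Open Scope ring_scope.

(** Expand the product over all [x] of 1 - [x in A]: choosing the second term exactly on [S]
    contributes (-1)^|S| if [S] lies in [A], and 0 otherwise. Any element of [A] makes the product
    vanish. *)
Lemma sum_sign_subset (R : comNzRingType) (T : finType) (A : {set T}) :
  \sum_(S : {set T} | S \subset A) (-1) ^+ #|S| = (A == set0)%:R :> R.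
Proof.
have -> : (A == set0)%:R = \prod_(x : T) (- (x \in A)%:R + 1) :> R.
  case: eqP => [->|/eqP /set0Pn[x xA]].
    by rewrite big1 // => x _; rewrite inE oppr0 add0r.
  by rewrite (bigD1 x) //= xA addNr mul0r.
rewrite bigA_distr big_mkcond /=; apply: eq_bigr => S _.
rewrite -big_mkcond /= prodrN; case: ifP => [/subsetP SA | /negbT /subsetPn[x xS xA]].
  by rewrite big1 ?mulr1 // => x /SA ->.
by rewrite (bigD1 x) //= (negPf xA) mul0r mulr0.
Qed.

Section AddEdges.
Variables (V : finType) (H : sgraph V) (S : {set V * V}).

(** Symmetrizing [S] and discarding its diagonal yields a simple graph for every set of ordered
    pairs. *)
Definition add_edges_adj : rel V :=
  fun a b => H a b || (a != b) && (((a, b) \in S) || ((b, a) \in S)).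

Lemma add_edges_sym : symmetric add_edges_adj.
Proof.
move=> a b; rewrite /add_edges_adj (adj_sym H) eq_sym.
by rewrite [((b, a) \in S) || _]orbC.
Qed.

Lemma add_edges_irrefl : irreflexive add_edges_adj.
Proof. by move=> a; rewrite /add_edges_adj (adj_irrefl H) eqxx. Qed.

Definition add_edges : sgraph V := SGraph add_edges_sym add_edges_irrefl.

Lemma proper_add_edges (n : nat) (c : {ffun V -> 'I_n}) :
    {in S, forall p, p.1 != p.2} ->
  proper_coloring add_edges c =
  proper_coloring H c && (S \subset [set p | c p.1 != c p.2]).
Proof.
move=> S_loopless; apply/forallP/andP => [Hc | [/forallP Hc /subsetP Sc] a].
  split; [apply/forallP => a; apply/forallP => b | apply/subsetP => -[a b] abS].
    by apply/implyP => Hab; have /forallP/(_ b) := Hc a; rewrite /= /add_edges_adj Hab.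
  rewrite inE; have /forallP/(_ b) := Hc a.
  by rewrite /= /add_edges_adj abS (S_loopless _ abS) orbT.
apply/forallP => b; apply/implyP => /orP[Hab | /andP[_ /orP[]/Sc]]; rewrite ?inE //=.
  by have /forallP/(_ b) := Hc a; rewrite Hab.
by rewrite eq_sym.
Qed.

End AddEdges.

(** Exchange the two sums. For a fixed coloring [c] proper for [H], the sets [S] that keep it proper
    are the subsets of the pairs in [Q] on which [c] differs, so their signs cancel unless there is
    no such pair. *)
Lemma sum_sign_wchrom_add_edges (V : finType) (H : sgraph V) (Q : {set V * V})
    (mu : V -> nat) (n : nat) :
    {in Q, forall p, p.1 != p.2} ->
  \sum_(S in powerset Q) (-1) ^+ #|S| *: wchrom (add_edges H S) mu n =
  \sum_(c : {ffun V -> 'I_n} |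
        proper_coloring H c && [forall p in Q, c p.1 == c p.2])
    'X^(\sum_v mu v * (c v).+1)%N.
Proof.
move=> Q_loopless.
under eq_bigr => S SQ.
  rewrite /wchrom scaler_sumr; under eq_bigl => c.
    rewrite proper_add_edges; first over.
    by move: SQ; rewrite powersetE => /subsetP SQ p /SQ /Q_loopless.
  over.
rewrite /= (exchange_big_dep (@proper_coloring V H n)) /=; last by move=> S c _ /andP[].
rewrite big_mkcondr; apply: eq_bigr => c Hc; rewrite -scaler_suml.
have -> : \sum_(S in powerset Q |
      proper_coloring H c && (S \subset [set p | c p.1 != c p.2])) (-1) ^+ #|S| =
    (Q :&: [set p | c p.1 != c p.2] == set0)%:R :> int.
  rewrite -sum_sign_subset; apply: eq_bigl => S.
  by rewrite powersetE subsetI Hc.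
have -> : (Q :&: [set p | c p.1 != c p.2] == set0) = [forall p in Q, c p.1 == c p.2].
  rewrite setI_eq0 disjoints_subset; apply/subsetP/forall_inP => Qc p /Qc; rewrite !inE.
    by rewrite negbK.
  by rewrite negbK.
by case: ifP => _; rewrite ?scale1r ?scale0r.
Qed.

Section Pullback.
Variables (V U : finType) (f : V -> U) (G : sgraph U).

Lemma pullback_sym : symmetric (relpre f G).
Proof. by move=> a b; rewrite /= (adj_sym G). Qed.

Lemma pullback_irrefl : irreflexive (relpre f G).
Proof. by move=> a; rewrite /= (adj_irrefl G). Qed.

Definition pullback : sgraph V := SGraph pullback_sym pullback_irrefl.

(** Each pair of clones occurs in both orders. This is harmless: imposing the same equality twice
    changes nothing, and the signed sum is valid for any loopless set of ordered pairs. *)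
Definition fiber_pairs : {set V * V} :=
  [set p | (f p.1 == f p.2) && (p.1 != p.2)].

(** Composition with [f] is a bijection from colorings of [G] to fiber-constant colorings of the
    pullback; its inverse is composition with a section [g] of [f]. *)
Lemma sum_pullback_wchrom (n : nat) :
    (forall u, exists v, f v = u) ->
  \sum_(c : {ffun V -> 'I_n} |
        proper_coloring pullback c && [forall p in fiber_pairs, c p.1 == c p.2])
    'X^(\sum_v 1 * (c v).+1)%N =
  wchrom G (fun u => #|f @^-1: [set u]|) n.
Proof.
move=> f_surj; have f_surjb u : exists v, f v == u.
  by have [v <-] := f_surj u; exists v.
pose g u := xchoose (f_surjb u).
have gK u : f (g u) = u by apply/eqP/(xchooseP (f_surjb u)).
pose h (c : {ffun U -> 'I_n}) : {ffun V -> 'I_n} := [ffun v => c (f v)].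
pose h' (c : {ffun V -> 'I_n}) : {ffun U -> 'I_n} := [ffun u => c (g u)].
rewrite (reindex_onto h h') => [|c /andP[_ /forall_inP c_const]]; last first.
  apply/ffunP => v; rewrite !ffunE.
  (* The representative [g (f v)] lies in the fiber of [v], so if it differs from [v] the two form a
     fiber pair. *)
  have [-> // | gfv] := eqVneq (g (f v)) v.
  by apply/eqP/(c_const (g (f v), v)); rewrite inE /= gK eqxx.
apply: eq_big => [c | c _].
  have -> : h' (h c) == c by apply/eqP/ffunP => u; rewrite !ffunE gK.
  have -> : [forall p in fiber_pairs, h c p.1 == h c p.2].
    by apply/forall_inP => p; rewrite inE !ffunE => /andP[/eqP-> _].
  rewrite !andbT; apply/forallP/forallP => Hc a; apply/forallP => b; apply/implyP.
    by have /forallP/(_ (g b)) := Hc (g a); rewrite /= !ffunE !gK => /implyP.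
  by have /forallP/(_ (f b)) := Hc (f a); rewrite /= !ffunE => /implyP.
(* Grouped by fibers, the unit weights add up to the fiber sizes. *)
congr 'X^_; rewrite (partition_big f predT) //=; apply: eq_bigr => u _.
rewrite -sum_nat_const; apply: eq_big => [v | v /eqP fv].
  by rewrite !inE.
by rewrite mul1n ffunE fv.
Qed.

End Pullback.

(** The clones are the pairs of some [u] and an index below [m u]; number them all and let [f]
    return the first component. *)
Lemma exists_map_card_fibers (U : finType) (m : U -> nat) :
  exists f : 'I_(\sum_u m u) -> U, forall u, #|f @^-1: [set u]| = m u.
Proof.
pose T : finType := {u : U & 'I_(m u)}.
have cardT : #|T| = (\sum_u m u)%N.
  rewrite card_tagged sumnE big_map big_enum /=.
  by apply: eq_bigr => u _; rewrite card_ord.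
pose t (i : 'I_(\sum_u m u)) : T := enum_val (cast_ord (esym cardT) i).
have t_bij : bijective t.
  exists (fun x => cast_ord cardT (enum_rank x)) => x; rewrite /t.
    by rewrite enum_valK cast_ordKV.
  by rewrite cast_ordK enum_rankK.
exists (fun i => tag (t i)) => u.
rewrite -sum1_card (eq_bigl (fun i => tag (t i) == u)); last by move=> i; rewrite !inE.
rewrite -(reindex t (P := fun x => tag x == u) (F := fun=> 1%N)); last exact: onW_bij.
transitivity (\sum_(v | v == u) \sum_(j : 'I_(m v)) 1)%N.
  by rewrite sig_big_dep; apply: eq_bigl => x; rewrite andbT.
by rewrite big_pred1_eq sum1_card card_ord.
Qed.

Theorem theorem17 (d : nat) (G : sgraph 'I_d) (lambda : 'I_d -> nat)
    (lambda_gt0 : forall v : 'I_d, (0 < lambda v)%N) :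
  exists (l : nat) (H : 'I_l -> sgraph 'I_(\sum_(v < d) lambda v)%N)
         (k : 'I_l -> int),
    forall n : nat, (0 < n)%N ->
      wchrom G lambda n = \sum_(i < l) k i *: wchrom (H i) (fun=> 1%N) n.
Proof.
have [f f_card] := exists_map_card_fibers lambda.
pose Q := fiber_pairs f.
pose S (i : 'I_#|powerset Q|) := enum_val i.
exists #|powerset Q|, (fun i => add_edges (pullback f G) (S i)),
  (fun i => (-1) ^+ #|S i|) => n _.
rewrite -(big_enum_val (fun T : {set _} =>
  (-1) ^+ #|T| *: wchrom (add_edges (pullback f G) T) (fun=> 1%N) n)).
rewrite sum_sign_wchrom_add_edges => [|p]; last by rewrite inE => /andP[].
rewrite sum_pullback_wchrom => [|u].
  rewrite /wchrom; apply: eq_bigr => c _; congr 'X^_.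
  by apply: eq_bigr => u _; rewrite f_card.
(* Positivity of the weights makes every fiber nonempty, hence [f] surjective. *)
have /card_gt0P[v] : (0 < #|f @^-1: [set u]|)%N by rewrite f_card.
by rewrite !inE => /eqP; exists v.
Qed.
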